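(* Let $r\in\{1,2,3,5,6,7,10,11,13,14,15\}$, let $k\in\mathbb{Z}$, and suppose $m=r+16k$ is a square-free integer with $m\neq 0,\pm1$. Let $K=\mathbb{Q}(\sqrt[4]{m})$. If $r\in\{2,3,6,7,10,11,14,15\}$ then $K$ is monogenic. If $r\in\{1,5,13\}$ then $K$ is not monogenic, with the exception of $K=\mathbb{Q}(\sqrt[4]{-3})$, which is monogenic.
   Context: A number field $K$ with ring of integers $\mathbb{Z}_K$ is called monogenic if there exists $\alpha\in\mathbb{Z}_K$ with $\mathbb{Z}_K=\mathbb{Z}[\alpha]$, i.e. $(1,\alpha,\ldots,\alpha^{\deg K-1})$ is an integral basis (a power integral basis). *)

(* Defs.v *)
From HB Require Import structures.
From mathcomp Require Import all_boot all_order all_algebra all_field.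
Set Implicit Arguments.
Unset Strict Implicit.
Unset Printing Implicit Defensive.
Import GRing.Theory.
Local Open Scope ring_scope.

(* A number field is a finite extension K : fieldExtType rat. *)

Definition ring_of_integers (K : fieldExtType rat) (x : K) : Prop :=
  integralOver (intr : int -> K) x.

Definition int_adjoin (K : fieldExtType rat) (a x : K) : Prop :=
  exists p : {poly int}, x = (map_poly intr p).[a].

Definition monogenic (K : fieldExtType rat) : Prop :=
  exists2 a : K, ring_of_integers a &
    forall x : K, ring_of_integers x <-> int_adjoin a x.

(* K = Q(a) for some fourth root a of m. When 'X^4 - m is irreducible over Q,
   as it is for square-free m other than 1 and -1, this determines K up to
   isomorphism, whichever fourth root is taken. *)
Definition is_pure_quartic (K : fieldExtType rat) (m : int) : Prop :=
  exists2 a : K, a ^+ 4 = m%:~R & <<1; a>>%VS = {:K}%VS.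

Definition square_free (m : int) : Prop :=
  forall d : int, (d ^+ 2 %| m)%Z -> d \is a GRing.unit.

(* Main.v *)
(**
Let a^4 = m. An integral x = (X0 + X1 a + X2 a^2 + X3 a^3) / 4 has integral
trace and norm in Q(sqrt m), and so does a x; this forces the Xi to be integers
subject to congruences modulo 4 and 8. Put w = (1 + a^2) / 2 and
e = w (1 + a) / 2. The congruences show that an integral basis is
1, a, a^2, a^3 when m = 2, 3 mod 4; 1, a, w, a w when m = 5 mod 8; and
1, a, w, e when m = 1 mod 16.

In the first case Z_K = Z[a]. If m = 5 mod 8, the index of
y w + u a + v a w is |N (m s^2 + 4 N^2)| with N = u^2 + u v - n v^2,
n = (m - 1) / 4 and s = y^2 - v (2 u + v); it equals 1 only if m = -3, and
then w + a is a generator. If m = 1 mod 16, then modulo 2 the elements w and e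
are idempotent and killed by a - 1, with w e = e, so every element of Z_K
differs by an integer from some y with y^3 = y^2 modulo 2, which leaves Z[y]
too small.
*)
Require Import Defs.
From HB Require Import structures.
From mathcomp Require Import all_boot all_order all_algebra all_field.
From mathcomp Require Import zify ring.
Set Implicit Arguments.
Unset Strict Implicit.
Unset Printing Implicit Defensive.
Import Order.TTheory GRing.Theory Num.Theory.
Local Open Scope ring_scope.

(** * Irreducibility of X^n - m for square-free m *)

Lemma int_unitE (d : int) : d \is a GRing.unit -> d = 1 \/ d = -1.
Proof. by move=> /pred2P. Qed.

Lemma square_free_prime (m : int) : square_free m -> m <> 0 -> m <> 1 ->
  m <> -1 -> exists p : nat, [/\ prime p, (p %| m)%Z & ~~ (p%:Z ^+ 2 %| m)%Z].
Proof.
move=> sf m0 m1 mN1; exists (pdiv `|m|%N).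
have am : (1 < `|m|)%N by lia.
have pp := pdiv_prime am.
split=> //; first by rewrite dvdzE pdiv_dvd.
by apply/negP=> /sf/int_unitE h; move: (prime_gt1 pp); lia.
Qed.

(** Eisenstein's criterion at a prime dividing m exactly once, carried from Z to Q. *)
Lemma irreducible_Xn_sub (m : int) (n : nat) : square_free m -> m <> 0 ->
  m <> 1 -> m <> -1 -> (0 < n)%N ->
  irreducible_poly ('X^n - (m%:~R)%:P : {poly rat}).
Proof.
move=> sf m0 m1 mN1 n0.
have -> : 'X^n - (m%:~R)%:P = map_poly intr ('X^n - m%:P) :> {poly rat}.
  by rewrite rmorphB /= map_polyXn map_polyC.
apply/irreducible_rat_int.
have [p [pp pm p2]] := square_free_prime sf m0 m1 mN1.
have sz : size ('X^n - m%:P) = n.+1 by rewrite size_XnsubC.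
apply: (eisenstein_crit pp).
- by rewrite sz eqSS -lt0n.
- rewrite (eqP (monicXnsubC m n0)); apply/negP.
  by rewrite dvdzE dvdn1 => /eqP h; move: (prime_gt1 pp); lia.
- by rewrite coefB coefXn coefC /= ltn_eqF // sub0r rpredN.
- move=> i; rewrite sz /= => lin; rewrite coefB coefXn coefC ltn_eqF //.
  by case: i {lin} => [|i] /=; rewrite sub0r rpredN ?rpred0.
Qed.

(** * Conjugates, and integrality over Z *)

(** Otherwise g is coprime to q, and coprimality persists over K, where it excludes a common
    root. *)
Lemma irreducible_root_dvd (K : fieldExtType rat) (q g : {poly rat}) (x : K) :
  irreducible_poly q -> root (map_poly (in_alg K) q) x ->
  root (map_poly (in_alg K) g) x -> q %| g.
Proof.
move=> irr qx gx; apply: contraT; rewrite -(irreducible_poly_coprime g irr).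
rewrite -(coprimep_map (in_alg K)) => /coprimep_root /(_ qx).
by rewrite -rootE gx.
Qed.

Lemma map_alg_int (K : fieldExtType rat) (f : {poly int}) :
  map_poly (in_alg K) (map_poly intr f) = map_poly intr f.
Proof.
rewrite -map_poly_comp; apply: eq_map_poly => z.
exact: (rmorph_int (in_alg K)).
Qed.

(** If a monic integer f kills p(x), then q divides f(p), so the same f kills p(y). *)
Lemma integral_conjugate (K : fieldExtType rat) (q p : {poly rat}) (x y : K) :
  irreducible_poly q -> root (map_poly (in_alg K) q) x ->
  root (map_poly (in_alg K) q) y ->
  ring_of_integers (map_poly (in_alg K) p).[x] ->
  ring_of_integers (map_poly (in_alg K) p).[y].
Proof.
move=> irr qx qy [f fm fx]; exists f => //.
have E z : (map_poly (in_alg K) (map_poly intr f \Po p)).[z]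
         = (map_poly intr f).[(map_poly (in_alg K) p).[z]].
  by rewrite map_comp_poly horner_comp map_alg_int.
have /dvdpP[g gE] : q %| map_poly intr f \Po p.
  by apply: (irreducible_root_dvd irr qx); rewrite rootE E.
by rewrite rootE -E gE rmorphM /= hornerM (eqP qy) mulr0.
Qed.

(** Z is integrally closed; the monic equation is moved to [algC], where rational algebraic integers
    are integers. *)
Lemma integral_rat (K : fieldExtType rat) (q : rat) :
  ring_of_integers (in_alg K q) -> exists z : int, q = z%:~R.
Proof.
case=> f fm; rewrite -map_alg_int fmorph_root => fq.
have : (ratr q : algC) \in Aint.
  apply: (@root_monic_Aint (map_poly intr f)).
  - have -> : map_poly intr f = map_poly (ratr : rat -> algC) (map_poly intr f).
      by rewrite -map_poly_comp; apply: eq_map_poly => z /=; rewrite ratr_int.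
    by rewrite fmorph_root.
  - by rewrite monic_map.
  - by apply/polyOverP => i; rewrite coef_map /= intr_int.
move/(Cint_rat_Aint (Crat_rat q))/intrP => [z zE].
exists z; apply: (fmorph_inj (ratr : {rmorphism rat -> algC})).
by rewrite [LHS]zE rmorph_int.
Qed.

(** With q in lowest terms, the square of its denominator divides m. *)
Lemma square_free_rat (m : int) (q : rat) (z : int) : square_free m ->
  m%:~R * q ^+ 2 = z%:~R -> exists t : int, q = t%:~R.
Proof.
move=> sf h.
have E : m * numq q ^+ 2 = z * denq q ^+ 2.
  apply: (@intr_inj rat); rewrite !(rmorphXn, rmorphM) /= -h.
  rewrite -[X in _ * X ^+ 2 * _]divq_num_den; field.
  by rewrite intr_eq0 denq_neq0.
have : (denq q ^+ 2 %| m)%Z.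
  rewrite -(@Gauss_dvdzl _ _ (numq q ^+ 2)); first by rewrite E dvdz_mull.
  by rewrite coprimezXl // coprimezXr // coprimez_sym coprimezE coprime_num_den.
move/sf/int_unitE => h1.
have d1 : denq q = 1 by case: h1 => // h1; have := denq_gt0 q; rewrite h1.
by exists (numq q); rewrite -{1}(divq_num_den q) d1 divr1.
Qed.

(** * Coordinates of integral elements in powers of a *)

Definition cubic (R : nzRingType) (c0 c1 c2 c3 : R) : {poly R} :=
  c0%:P + c1%:P * 'X + c2%:P * 'X^2 + c3%:P * 'X^3.

Lemma horner_map_cubic (F K : comNzRingType) (f : {rmorphism F -> K})
    (c0 c1 c2 c3 : F) (x : K) :
  (map_poly f (cubic c0 c1 c2 c3)).[x]
  = f c0 + f c1 * x + f c2 * x ^+ 2 + f c3 * x ^+ 3.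
Proof.
by rewrite !(rmorphD, rmorphXn, rmorphM) /= !map_polyC /= map_polyX !hornerE.
Qed.

Lemma cubicE (R : nzRingType) (p : {poly R}) : (size p <= 4)%N ->
  p = cubic p`_0 p`_1 p`_2 p`_3.
Proof.
move=> sp; apply/polyP => i; rewrite !coefD !coefCM coefC coefX !coefXn.
case: i => [|[|[|[|i]]]] /=; rewrite ?(mulr0, mulr1, addr0, add0r) //.
by rewrite nth_default // (leq_trans sp).
Qed.

Lemma size_cubic (R : nzRingType) (c0 c1 c2 c3 : R) :
  (size (cubic c0 c1 c2 c3) <= 4)%N.
Proof.
apply/leq_sizeP => i; rewrite !coefD !coefCM coefC coefX !coefXn.
by case: i => [|[|[|[|i]]]] //= _; rewrite !(mulr0, addr0).
Qed.

Lemma cubic_eq0 (R : nzRingType) (c0 c1 c2 c3 : R) :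
  cubic c0 c1 c2 c3 = 0 -> [/\ c0 = 0, c1 = 0, c2 = 0 & c3 = 0].
Proof.
move=> /polyP h; split; [have := h 0 | have := h 1 | have := h 2 | have := h 3];
  by rewrite !coefD !coefCM coefC coefX !coefXn coef0 /=
     ?(mulr0, mulr1, addr0, add0r).
Qed.

Lemma root_map_Xn_sub (F K : fieldType) (f : {rmorphism F -> K}) (m : int)
    (n : nat) (x : K) :
  x ^+ n = m%:~R -> root (map_poly f ('X^n - (m%:~R)%:P)) x.
Proof.
move=> h; rewrite rootE rmorphB /= map_polyXn map_polyC !hornerE h /=.
by rewrite rmorph_int subrr.
Qed.

(* The sum and the product with the conjugate at -s are rational integers. *)
Lemma quadratic_integral (K : fieldExtType rat) (m : int) (s : K) (p q : rat) :
  square_free m -> m <> 0 -> m <> 1 -> m <> -1 -> s ^+ 2 = m%:~R ->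
  ring_of_integers (in_alg K p + in_alg K q * s) ->
  exists P Q t : int,
    [/\ 2 * p = P%:~R, 2 * q = Q%:~R & P ^+ 2 - m * Q ^+ 2 = 4 * t].
Proof.
move=> sf m0 m1 mN1 hs hi.
have hi' : ring_of_integers (in_alg K p - in_alg K q * s).
  have := @integral_conjugate K ('X^2 - (m%:~R)%:P) (cubic p q 0 0) s (- s).
  rewrite !horner_map_cubic !rmorph0 !mul0r !addr0 mulrN; apply=> //.
  - exact: irreducible_Xn_sub.
  - exact: root_map_Xn_sub.
  - by apply: root_map_Xn_sub; rewrite sqrrN.
have [P hP] : exists P : int, 2 * p = P%:~R.
  apply: (@integral_rat K); have := integral_add hi hi'.
  by congr ring_of_integers; ring.
have [t ht] : exists t : int, p ^+ 2 - m%:~R * q ^+ 2 = t%:~R.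
  apply: (@integral_rat K); have := integral_mul hi hi'.
  by congr ring_of_integers; ring: hs.
have hPt : m%:~R * (2 * q) ^+ 2 = (P ^+ 2 - 4 * t)%:~R.
  by rewrite rmorphB rmorphXn rmorphM /= -hP -ht; ring.
have [Q hQ] := square_free_rat sf hPt.
exists P, Q, t; split=> //; apply: (@intr_inj rat).
by rewrite !(rmorphB, rmorphXn, rmorphM) /= -hP -hQ -ht; ring.
Qed.

Lemma quartic_span (K : fieldExtType rat) (m : int) (a x : K) :
  a ^+ 4 = m%:~R -> <<1; a>>%VS = {:K}%VS -> exists c0 c1 c2 c3 : rat,
  x = in_alg K c0 + in_alg K c1 * a + in_alg K c2 * a ^+ 2
      + in_alg K c3 * a ^+ 3.
Proof.
move=> ha hgen; have /Fadjoin1_polyP[p ->] : x \in <<1; a>>%VS.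
  by rewrite hgen memvf.
pose q : {poly rat} := 'X^4 - (m%:~R)%:P.
have -> : (map_poly (in_alg K) p).[a] = (map_poly (in_alg K) (p %% q)).[a].
  rewrite {1}(divp_eq p q) rmorphD rmorphM hornerD hornerM /=.
  by rewrite (eqP (root_map_Xn_sub (in_alg K) ha)) mulr0 add0r.
have /cubicE -> : (size (p %% q)%R <= 4)%N.
  rewrite -ltnS -(size_XnsubC (m%:~R : rat) (isT : 0 < 4)%N) ltn_modp.
  by rewrite -size_poly_gt0 size_XnsubC.
by rewrite horner_map_cubic; do 4!eexists.
Qed.

(** A relation is a polynomial of degree at most 3 divisible by the irreducible X^4 - m. *)
Lemma quartic_independent (K : fieldExtType rat) (m : int) (a : K)
    (c0 c1 c2 c3 : rat) :
  square_free m -> m <> 0 -> m <> 1 -> m <> -1 -> a ^+ 4 = m%:~R ->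
  in_alg K c0 + in_alg K c1 * a + in_alg K c2 * a ^+ 2
    + in_alg K c3 * a ^+ 3 = 0 ->
  [/\ c0 = 0, c1 = 0, c2 = 0 & c3 = 0].
Proof.
move=> sf m0 m1 mN1 ha; rewrite -horner_map_cubic => h; apply: cubic_eq0.
have irr := irreducible_Xn_sub sf m0 m1 mN1 (isT : 0 < 4)%N.
have := irreducible_root_dvd irr (root_map_Xn_sub (in_alg K) ha) (introT eqP h).
apply: contraTeq => nz; apply/negP => /(dvdp_leq nz).
by rewrite size_XnsubC // leqNgt ltnS size_cubic.
Qed.

(** The conjugation a -> -a fixes Q(a^2), so the sum and the product of x with its image lie in that
    quadratic field. *)
Lemma quartic_integral_conj (K : fieldExtType rat) (m : int) (a : K)
    (c0 c1 c2 c3 : rat) :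
  square_free m -> m <> 0 -> m <> 1 -> m <> -1 -> a ^+ 4 = m%:~R ->
  ring_of_integers (in_alg K c0 + in_alg K c1 * a + in_alg K c2 * a ^+ 2
    + in_alg K c3 * a ^+ 3) ->
  ring_of_integers (in_alg K c0 - in_alg K c1 * a + in_alg K c2 * a ^+ 2
    - in_alg K c3 * a ^+ 3).
Proof.
move=> sf m0 m1 mN1 ha hi.
have := @integral_conjugate K ('X^4 - (m%:~R)%:P) (cubic c0 c1 c2 c3) a (- a).
have -> : in_alg K c0 - in_alg K c1 * a + in_alg K c2 * a ^+ 2
    - in_alg K c3 * a ^+ 3 = (map_poly (in_alg K) (cubic c0 c1 c2 c3)).[- a].
  by rewrite horner_map_cubic; ring.
rewrite [X in ring_of_integers X -> _]horner_map_cubic; apply=> //.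
- exact: irreducible_Xn_sub.
- exact: root_map_Xn_sub.
- by apply: root_map_Xn_sub; rewrite -ha; ring.
Qed.

Lemma integral_intr (K : fieldExtType rat) (z : int) :
  ring_of_integers (z%:~R : K).
Proof. exact: (integral_id (intr : {rmorphism int -> K})). Qed.

Lemma integral_Xn_root (K : fieldExtType rat) (m : int) (n : nat) (a : K) :
  (0 < n)%N -> a ^+ n = m%:~R -> ring_of_integers a.
Proof.
move=> n0 ha; exists ('X^n - m%:P); first exact: monicXnsubC.
by rewrite rootE rmorphB /= map_polyXn map_polyC !hornerE ha subrr.
Qed.

Lemma quartic_integral_coords (K : fieldExtType rat) (m : int) (a x : K) :
  square_free m -> m <> 0 -> m <> 1 -> m <> -1 -> a ^+ 4 = m%:~R ->
  <<1; a>>%VS = {:K}%VS -> ring_of_integers x ->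
  exists X0 X1 X2 X3 U V s t r : int,
  [/\ x *+ 4 = X0%:~R + X1%:~R * a + X2%:~R * a ^+ 2 + X3%:~R * a ^+ 3,
      X0 ^+ 2 - m * X2 ^+ 2 = 4 * s /\ m * (X1 ^+ 2 - m * X3 ^+ 2) = 4 * t,
      X0 ^+ 2 + m * X2 ^+ 2 - 2 * m * X1 * X3 = 8 * U,
      2 * X0 * X2 - X1 ^+ 2 - m * X3 ^+ 2 = 8 * V &
      U ^+ 2 - m * V ^+ 2 = 4 * r].
Proof.
move=> sf m0 m1 mN1 ha hgen hx.
have [c0 [c1 [c2 [c3 xE]]]] := quartic_span x ha hgen.
have ha2 : (a ^+ 2) ^+ 2 = m%:~R by rewrite -ha; ring.
have hi := hx; rewrite xE in hi.
have hi' := quartic_integral_conj sf m0 m1 mN1 ha hi.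
have [X0 [X2 [s [hX0 hX2 hs]]]] : exists P Q t : int,
    [/\ 2 * (2 * c0) = P%:~R, 2 * (2 * c2) = Q%:~R
      & P ^+ 2 - m * Q ^+ 2 = 4 * t].
  apply: (quadratic_integral sf m0 m1 mN1 ha2).
  by have := integral_add hi hi'; congr ring_of_integers; ring.
(* The trace of a x to Q(a^2) is 2 m c3 + 2 c1 a^2. *)
have [Y [X1 [t [hY hX1 ht]]]] : exists P Q t : int,
    [/\ 2 * (2 * (m%:~R * c3)) = P%:~R, 2 * (2 * c1) = Q%:~R
      & P ^+ 2 - m * Q ^+ 2 = 4 * t].
  apply: (quadratic_integral sf m0 m1 mN1 ha2).
  have := integral_mul (integral_Xn_root (isT : 0 < 4)%N ha)
    (integral_sub hi hi').
  by congr ring_of_integers; ring: ha.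
(* The norm of x to Q(a^2), the product of x and its conjugate; U and V are twice its coordinates on
   1 and a^2. *)
have [U [V [r [hU hV hr]]]] : exists P Q t : int,
    [/\ 2 * (c0 ^+ 2 + m%:~R * c2 ^+ 2 - 2 * m%:~R * c1 * c3) = P%:~R,
        2 * (2 * c0 * c2 - c1 ^+ 2 - m%:~R * c3 ^+ 2) = Q%:~R
      & P ^+ 2 - m * Q ^+ 2 = 4 * t].
  apply: (quadratic_integral sf m0 m1 mN1 ha2).
  by have := integral_mul hi hi'; congr ring_of_integers; ring: ha.
(* The trace of a x only shows that 4 m c3 is an integer. The equation for V makes m (4 c3)^2 an
   integer, and square-freeness then removes m. *)
have [X3 hX3] : exists X3 : int, 4 * c3 = X3%:~R.
  apply: (@square_free_rat m _ (2 * X0 * X2 - X1 ^+ 2 - 8 * V)) => //.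
  by rewrite !(rmorphB, rmorphXn, rmorphM) /= -hX0 -hX2 -hX1 -hV; ring.
have EY : Y = m * X3.
  by apply: (@intr_inj rat); rewrite rmorphM /= -hY -hX3; ring.
exists X0, X1, X2, X3, U, V, s, (- t), r; split=> //.
- rewrite xE -!(rmorph_int (in_alg K)) -hX0 -hX1 -hX2 -hX3; ring.
- by split=> //; move: ht; rewrite EY; lia.
- apply: (@intr_inj rat).
  rewrite !(rmorphB, rmorphD, rmorphXn, rmorphM) /= -hX0 -hX1 -hX2 -hX3 -hU.
  ring.
- apply: (@intr_inj rat).
  rewrite !(rmorphB, rmorphD, rmorphXn, rmorphM) /= -hX0 -hX1 -hX2 -hX3 -hV.
  ring.
Qed.

(** * Congruences satisfied by the coordinates *)

Lemma parity_cases (x : int) : exists y : int, x = 2 * y \/ x = 2 * y + 1.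
Proof. exists (x %/ 2)%Z; lia. Qed.

(** Modulo 4 squares are 0 or 1, and the form is p^2 + 2 q^2 or p^2 + q^2. *)
Lemma even_square_sum_mod4 (m p q t : int) :
  (exists n : int, m = 4 * n + 2 \/ m = 4 * n + 3) ->
  p ^+ 2 - m * q ^+ 2 = 4 * t -> exists p' q' : int, p = 2 * p' /\ q = 2 * q'.
Proof.
move=> [n hn] h.
have [p' hp] := parity_cases p; have [q' hq] := parity_cases q.
exists p', q'.
by case: hn => ?; case: hp => ?; case: hq => ?; subst; first [by split | lia].
Qed.

(** The equation in V excludes every odd case but X1, X3 both odd with m = 3 modulo 4; there m (X1^2
    - m X3^2) is 2 modulo 4. *)
Lemma odd_coords_even (m X0 X1 X2 X3 t V : int) :
  (exists n : int, m = 4 * n + 2 \/ m = 4 * n + 3) ->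
  m * (X1 ^+ 2 - m * X3 ^+ 2) = 4 * t ->
  8 * X0 * X2 - X1 ^+ 2 - m * X3 ^+ 2 = 8 * V ->
  exists Y1 Y3 : int, X1 = 2 * Y1 /\ X3 = 2 * Y3.
Proof.
move=> [n hn] h1 hV.
have [Y1 hY1] := parity_cases X1; have [Y3 hY3] := parity_cases X3.
exists Y1, Y3.
by case: hn => ?; case: hY1 => ?; case: hY3 => ?; subst;
  first [by split | clear h1; lia | clear hV; lia].
Qed.

(** For m = 3 modulo 4, parity gives X0 = X2 and X1 = X3 modulo 2, and each mixed or odd case leaves
    2 modulo 4 in one equation. For m = 2 modulo 4, X0 and X1 are even at once, then X2 and X3. *)
Lemma half_coords_even (m X0 X1 X2 X3 U V : int) :
  (exists n : int, m = 4 * n + 2 \/ m = 4 * n + 3) ->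
  X0 ^+ 2 + m * X2 ^+ 2 - 2 * m * X1 * X3 = 4 * U ->
  2 * X0 * X2 - X1 ^+ 2 - m * X3 ^+ 2 = 4 * V ->
  exists Y0 Y1 Y2 Y3 : int,
    [/\ X0 = 2 * Y0, X1 = 2 * Y1, X2 = 2 * Y2 & X3 = 2 * Y3].
Proof.
move=> [n hn] hU hV.
have [Y0 hY0] := parity_cases X0; have [Y1 hY1] := parity_cases X1.
have [Y2 hY2] := parity_cases X2; have [Y3 hY3] := parity_cases X3.
exists Y0, Y1, Y2, Y3.
by case: hn => ?; case: hY0 => ?; case: hY1 => ?; case: hY2 => ?;
  case: hY3 => ?; subst; first [by split | clear hU; lia | clear hV; lia].
Qed.

(** Halving twice: the trace makes X0, X2 even and the norm condition makes U, V even; then X1, X3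
    are even, and the halved equations still force all four to be even. *)
Lemma coords_mod4_2_3 (m X0 X1 X2 X3 U V s t r : int) :
  (exists n : int, m = 4 * n + 2 \/ m = 4 * n + 3) ->
  X0 ^+ 2 - m * X2 ^+ 2 = 4 * s -> m * (X1 ^+ 2 - m * X3 ^+ 2) = 4 * t ->
  X0 ^+ 2 + m * X2 ^+ 2 - 2 * m * X1 * X3 = 8 * U ->
  2 * X0 * X2 - X1 ^+ 2 - m * X3 ^+ 2 = 8 * V ->
  U ^+ 2 - m * V ^+ 2 = 4 * r ->
  exists Y0 Y1 Y2 Y3 : int,
    [/\ X0 = 4 * Y0, X1 = 4 * Y1, X2 = 4 * Y2 & X3 = 4 * Y3].
Proof.
move=> hm h0 h1 hU hV hr.
have [Y0 [Y2 [e0 e2]]] := even_square_sum_mod4 hm h0.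
have [U' [V' [eU eV]]] := even_square_sum_mod4 hm hr.
subst X0 X2 U V.
have [|Y1 [Y3 [e1 e3]]] := @odd_coords_even m Y0 X1 Y2 X3 t (2 * V') hm h1.
  by rewrite -hV; ring.
subst X1 X3.
have [||Z0 [Z1 [Z2 [Z3 []]]]] := @half_coords_even m Y0 Y1 Y2 Y3 U' V' hm.
- by apply: (@mulfI _ 4) => //;
  transitivity (8 * (2 * U')); [rewrite -hU|]; ring.
- by apply: (@mulfI _ 4) => //;
  transitivity (8 * (2 * V')); [rewrite -hV|]; ring.
by move=> -> -> -> ->; exists Z0, Z1, Z2, Z3; split; ring.
Qed.

Lemma odd_square_sum_parity (m p q t : int) :
  (exists n : int, m = 2 * n + 1) -> p ^+ 2 - m * q ^+ 2 = 2 * t ->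
  exists d : int, p = q + 2 * d.
Proof.
move=> [n hn] h.
have [p' hp] := parity_cases p; have [q' hq] := parity_cases q.
exists (p' - q').
by case: hp => ?; case: hq => ?; subst; lia.
Qed.

Lemma coords_parity (m X0 X1 X2 X3 U V s t r : int) :
  (exists n : int, m = 2 * n + 1) ->
  X0 ^+ 2 - m * X2 ^+ 2 = 4 * s -> m * (X1 ^+ 2 - m * X3 ^+ 2) = 4 * t ->
  U ^+ 2 - m * V ^+ 2 = 4 * r ->
  exists d0 d1 e : int,
    [/\ X0 = X2 + 2 * d0, X1 = X3 + 2 * d1 & U = V + 2 * e].
Proof.
move=> hm h0 h1 hr.
have [|d0 ->] := @odd_square_sum_parity m X0 X2 (2 * s) hm.
  by rewrite h0; ring.
have [|e ->] := @odd_square_sum_parity m U V (2 * r) hm.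
  by rewrite hr; ring.
(* The odd factor m = 2 n + 1 is stripped by subtracting 2 n times the difference X1^2 - m X3^2. *)
have [n hn] := hm.
have [|d1 ->] :=
    @odd_square_sum_parity m X1 X3 (2 * t - n * (X1 ^+ 2 - m * X3 ^+ 2)) hm.
  by move: h1; rewrite hn; lia.
by exists d0, d1, e.
Qed.

(** The Yi are to be the coordinates of x on 1, a, w, a w, as read from 4 x. *)
Lemma coords_mod8_5 (m X0 X1 X2 X3 U V s t r : int) :
  (exists n : int, m = 8 * n + 5) ->
  X0 ^+ 2 - m * X2 ^+ 2 = 4 * s -> m * (X1 ^+ 2 - m * X3 ^+ 2) = 4 * t ->
  X0 ^+ 2 + m * X2 ^+ 2 - 2 * m * X1 * X3 = 8 * U ->
  2 * X0 * X2 - X1 ^+ 2 - m * X3 ^+ 2 = 8 * V ->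
  U ^+ 2 - m * V ^+ 2 = 4 * r ->
  exists Y0 Y1 Y2 Y3 : int,
    [/\ X0 = 2 * Y2 + 4 * Y0, X1 = 2 * Y3 + 4 * Y1, X2 = 2 * Y2
      & X3 = 2 * Y3].
Proof.
move=> [n hn] h0 h1 hU hV hr.
have hm : exists n : int, m = 2 * n + 1 by exists (4 * n + 2); rewrite hn; ring.
have [d0 [d1 [e [e0 e1 eU]]]] := coords_parity hm h0 h1 hr.
clear h0 h1 hr hm; subst X0 X1 U m.
(* Modulo 16 the difference rules out X3 odd; hU and hV alone do not. *)
have hUV := congr2 (fun x y => x - y) hU hV.
have [Z0 hZ0] := parity_cases d0; have [Z1 hZ1] := parity_cases d1.
have [Y2 hY2] := parity_cases X2; have [Y3 hY3] := parity_cases X3.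
exists Z0, Z1, Y2, Y3.
by case: hZ0 => ?; case: hZ1 => ?; case: hY2 => ?; case: hY3 => ?; subst;
  first [by split; ring | clear hU hV; lia | clear hV hUV; lia
        | clear hU hUV; lia].
Qed.

(** Since 4 e = 1 + a + a^2 + a^3, the integers Y0, Y1, Y2, X3 are to be the coordinates of x on 1,
    a, w, e. Here X3 may be odd. *)
Lemma coords_mod8_1 (m X0 X1 X2 X3 U V s t r : int) :
  (exists n : int, m = 8 * n + 1) ->
  X0 ^+ 2 - m * X2 ^+ 2 = 4 * s -> m * (X1 ^+ 2 - m * X3 ^+ 2) = 4 * t ->
  X0 ^+ 2 + m * X2 ^+ 2 - 2 * m * X1 * X3 = 8 * U ->
  2 * X0 * X2 - X1 ^+ 2 - m * X3 ^+ 2 = 8 * V ->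
  U ^+ 2 - m * V ^+ 2 = 4 * r ->
  exists Y0 Y1 Y2 : int,
    [/\ X0 = X3 + 2 * Y2 + 4 * Y0, X1 = X3 + 4 * Y1 & X2 = X3 + 2 * Y2].
Proof.
move=> [n hn] h0 h1 hU hV hr.
have hm : exists n : int, m = 2 * n + 1 by exists (4 * n); rewrite hn; ring.
have [d0 [d1 [e [e0 e1 _]]]] := coords_parity hm h0 h1 hr.
clear h0 h1 hr hm; subst X0 X1 m.
have [Z0 hZ0] := parity_cases d0; have [Z1 hZ1] := parity_cases d1.
have [Y2 hY2] := parity_cases X2; have [Y3 hY3] := parity_cases X3.
exists Z0, Z1, (Y2 - Y3).
by case: hZ0 => ?; case: hZ1 => ?; case: hY2 => ?; case: hY3 => ?; subst;
  first [by split; ring | clear hV; lia | clear hU; lia].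
Qed.

(** * Integral elements and the rings Z[a] *)

Lemma intr_alg_neq0 (K : fieldExtType rat) (z : int) :
  z != 0 -> z%:~R != 0 :> K.
Proof.
by move=> z0; rewrite -(rmorph_int (in_alg K)) fmorph_eq0 intr_eq0.
Qed.

Lemma quartic_int_independent (K : fieldExtType rat) (m : int) (a : K)
    (X0 X1 X2 X3 : int) :
  square_free m -> m <> 0 -> m <> 1 -> m <> -1 -> a ^+ 4 = m%:~R ->
  X0%:~R + X1%:~R * a + X2%:~R * a ^+ 2 + X3%:~R * a ^+ 3 = 0 ->
  [/\ X0 = 0, X1 = 0, X2 = 0 & X3 = 0].
Proof.
move=> sf m0 m1 mN1 ha; rewrite -!(rmorph_int (in_alg K)).
move/(quartic_independent sf m0 m1 mN1 ha) => [/eqP h0 /eqP h1 /eqP h2 /eqP h3].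
by move: h0 h1 h2 h3; rewrite !intr_eq0 => /eqP -> /eqP -> /eqP -> /eqP ->.
Qed.

(** Transitivity of integrality. Coefficients in K are allowed because e is quadratic over Z[w]. *)
Lemma integral_quadratic (K : fieldExtType rat) (u v x : K) :
  ring_of_integers u -> ring_of_integers v -> x ^+ 2 = u * x + v ->
  ring_of_integers x.
Proof.
move=> hu hv hx; pose p : {poly K} := 'X^2 - (u%:P * 'X + v%:P).
have sp : (size (u%:P * 'X + v%:P : {poly K})%R < size ('X^2 : {poly K})%R)%N.
  by rewrite size_polyXn ltnS size_MXaddC; case: ifP => // _;
     rewrite ltnS size_polyC_leq1.
apply: (@integral_root_monic _ _ (intr : {rmorphism int -> K}) x p).
- by rewrite monicE lead_coefDl ?size_polyN // lead_coefXn.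
- by rewrite rootE !hornerE hx subrr.
- apply/integral_poly => i; rewrite coefB coefD coefXn coefCM coefX coefC.
  apply: integral_sub; first
    by case: (i == 2); [exact: integral1|exact: integral0].
  apply: integral_add; last by case: (i == 0)=> //; exact: integral0.
  apply: integral_mul => //.
  by case: (i == 1); [exact: integral1|exact: integral0].
Qed.

Lemma int_adjoin_intr (K : fieldExtType rat) (a : K) (z : int) :
  int_adjoin a z%:~R.
Proof. by exists z%:P; rewrite map_polyC hornerC. Qed.

Lemma int_adjoin_gen (K : fieldExtType rat) (a : K) : int_adjoin a a.
Proof. by exists 'X; rewrite map_polyX hornerX. Qed.

Lemma int_adjoin_add (K : fieldExtType rat) (a x y : K) :
  int_adjoin a x -> int_adjoin a y -> int_adjoin a (x + y).
Proof. by move=> [p ->] [q ->]; exists (p + q); rewrite rmorphD hornerD. Qed.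

Lemma int_adjoin_mul (K : fieldExtType rat) (a x y : K) :
  int_adjoin a x -> int_adjoin a y -> int_adjoin a (x * y).
Proof. by move=> [p ->] [q ->]; exists (p * q); rewrite rmorphM hornerM. Qed.

Lemma int_adjoin_integral (K : fieldExtType rat) (a x : K) :
  ring_of_integers a -> int_adjoin a x -> ring_of_integers x.
Proof.
move=> ha [p ->]; apply: (integral_horner (RtoK := intr)) => //.
by apply/integral_poly => i; rewrite coef_map; exact: integral_intr.
Qed.

(** * The case m = 2, 3 modulo 4 *)

Lemma monogenic_mod4_2_3 (K : fieldExtType rat) (m : int) :
  (exists n : int, m = 4 * n + 2 \/ m = 4 * n + 3) ->
  square_free m -> m <> 0 -> m <> 1 -> m <> -1 -> is_pure_quartic K m ->
  monogenic K.
Proof.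
move=> hm sf m0 m1 mN1 [a ha hgen].
have ia := integral_Xn_root (isT : 0 < 4)%N ha.
exists a => // x; split; last exact: int_adjoin_integral.
move=> hx.
have [X0 [X1 [X2 [X3 [U [V [s [t [r [xE [h0 h1] hU hV hr]]]]]]]]]] :=
  quartic_integral_coords sf m0 m1 mN1 ha hgen hx.
have [Y0 [Y1 [Y2 [Y3 [e0 e1 e2 e3]]]]] := coords_mod4_2_3 hm h0 h1 hU hV hr.
exists (cubic Y0 Y1 Y2 Y3); rewrite horner_map_cubic.
apply: (mulfI (intr_alg_neq0 K (isT : (4 : int) != 0))).
transitivity (x *+ 4); first by ring.
by rewrite xE e0 e1 e2 e3; ring.
Qed.

(** * Integral bases for m = 1 modulo 4 *)

(** The two relations are all that is later used of w; [ring] takes them as rewriting rules. *)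
Lemma quartic_omega (K : fieldExtType rat) (m n : int) (a : K) :
  m = 4 * n + 1 -> a ^+ 4 = m%:~R ->
  exists2 w : K, a ^+ 2 = 2 * w - 1 & w ^+ 2 = w + n%:~R.
Proof.
move=> hm ha; have n2 := intr_alg_neq0 K (isT : (2 : int) != 0).
have n4 := intr_alg_neq0 K (isT : (4 : int) != 0).
exists ((1 + a ^+ 2) / 2); first by field.
have -> : n%:~R = (a ^+ 4 - 1) / 4 :> K.
  by rewrite ha hm; field.
by field; rewrite n2 n4.
Qed.

Lemma integral_omega (K : fieldExtType rat) (n : int) (w : K) :
  w ^+ 2 = w + n%:~R -> ring_of_integers w.
Proof.
move=> hw; apply: (@integral_quadratic _ 1 n%:~R); last by rewrite mul1r.
  exact: integral1.
exact: integral_intr.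
Qed.

Lemma integral_basis_mod8_5 (K : fieldExtType rat) (m : int) (a w x : K) :
  (exists n : int, m = 8 * n + 5) ->
  square_free m -> m <> 0 -> m <> 1 -> m <> -1 -> a ^+ 4 = m%:~R ->
  <<1; a>>%VS = {:K}%VS -> a ^+ 2 = 2 * w - 1 -> ring_of_integers x ->
  exists Y0 Y1 Y2 Y3 : int,
    x = Y0%:~R + Y1%:~R * a + Y2%:~R * w + Y3%:~R * (a * w).
Proof.
move=> hm sf m0 m1 mN1 ha hgen haw hx.
have [X0 [X1 [X2 [X3 [U [V [s [t [r [xE [h0 h1] hU hV hr]]]]]]]]]] :=
  quartic_integral_coords sf m0 m1 mN1 ha hgen hx.
have [Y0 [Y1 [Y2 [Y3 [e0 e1 e2 e3]]]]] := coords_mod8_5 hm h0 h1 hU hV hr.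
exists Y0, Y1, Y2, Y3.
apply: (mulfI (intr_alg_neq0 K (isT : (4 : int) != 0))).
transitivity (x *+ 4); first by ring.
by rewrite xE e0 e1 e2 e3; ring: haw.
Qed.

Lemma integral_basis_mod8_1 (K : fieldExtType rat) (m : int) (a w e x : K) :
  (exists n : int, m = 8 * n + 1) ->
  square_free m -> m <> 0 -> m <> 1 -> m <> -1 -> a ^+ 4 = m%:~R ->
  <<1; a>>%VS = {:K}%VS -> a ^+ 2 = 2 * w - 1 -> a * w = 2 * e - w ->
  ring_of_integers x ->
  exists Y0 Y1 Y2 Y3 : int,
    x = Y0%:~R + Y1%:~R * a + Y2%:~R * w + Y3%:~R * e.
Proof.
move=> hm sf m0 m1 mN1 ha hgen haw hawe hx.
have [X0 [X1 [X2 [X3 [U [V [s [t [r [xE [h0 h1] hU hV hr]]]]]]]]]] :=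
  quartic_integral_coords sf m0 m1 mN1 ha hgen hx.
have [Y0 [Y1 [Y2 [e0 e1 e2]]]] := coords_mod8_1 hm h0 h1 hU hV hr.
exists Y0, Y1, Y2, X3.
apply: (mulfI (intr_alg_neq0 K (isT : (4 : int) != 0))).
transitivity (x *+ 4); first by ring.
by rewrite xE e0 e1 e2; ring: haw hawe.
Qed.

Lemma quartic_omega_independent (K : fieldExtType rat) (m : int) (a w : K)
    (Z0 Z1 Z2 Z3 : int) :
  square_free m -> m <> 0 -> m <> 1 -> m <> -1 -> a ^+ 4 = m%:~R ->
  a ^+ 2 = 2 * w - 1 ->
  Z0%:~R + Z1%:~R * a + Z2%:~R * w + Z3%:~R * (a * w) = 0 ->
  [/\ Z0 = 0, Z1 = 0, Z2 = 0 & Z3 = 0].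
Proof.
move=> sf m0 m1 mN1 ha haw h.
have : (2 * Z0 + Z2)%:~R + (2 * Z1 + Z3)%:~R * a + Z2%:~R * a ^+ 2
       + Z3%:~R * a ^+ 3 = 0.
  rewrite -[RHS](mulr0 2) -h; ring: haw.
by move/(quartic_int_independent sf m0 m1 mN1 ha) => [? ? ? ?]; split; lia.
Qed.

Lemma quartic_eta_independent (K : fieldExtType rat) (m : int) (a w e : K)
    (Z0 Z1 Z2 Z3 : int) :
  square_free m -> m <> 0 -> m <> 1 -> m <> -1 -> a ^+ 4 = m%:~R ->
  a ^+ 2 = 2 * w - 1 -> a * w = 2 * e - w ->
  Z0%:~R + Z1%:~R * a + Z2%:~R * w + Z3%:~R * e = 0 ->
  [/\ Z0 = 0, Z1 = 0, Z2 = 0 & Z3 = 0].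
Proof.
move=> sf m0 m1 mN1 ha haw hawe h.
have : (4 * Z0 + 2 * Z2 + Z3)%:~R + (4 * Z1 + Z3)%:~R * a
       + (2 * Z2 + Z3)%:~R * a ^+ 2 + Z3%:~R * a ^+ 3 = 0.
  rewrite -[RHS](mulr0 4) -h; ring: haw hawe.
by move/(quartic_int_independent sf m0 m1 mN1 ha) => [? ? ? ?]; split; lia.
Qed.

(** * The exceptional field, m = -3 *)

(** For w + a, that is u = y = 1 and v = 0, the index form has N = s = 1 and m + 4 = 1. *)
Lemma monogenic_N3 (K : fieldExtType rat) : is_pure_quartic K (-3) ->
  monogenic K.
Proof.
move=> [a ha hgen].
have sf : square_free (-3).
  move=> d; rewrite dvdzE abszX => h.
  have d2 : (`|d| < 2)%N.
    rewrite ltnNge; apply/negP => d2; rewrite -mulnn in h.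
    by have := leq_trans (leq_mul d2 d2) (dvdn_leq (isT : 0 < 3)%N h).
  have d0 : d <> 0 by move=> d0; move: h; rewrite d0.
  have [-> | ->] : d = 1 \/ d = -1 by lia.
    by [].
  by [].
have hm4 : -3 = 4 * (-1) + 1 :> int by [].
have [w haw hw] := quartic_omega hm4 ha.
have iw := integral_omega hw; have ia := integral_Xn_root (isT : 0 < 4)%N ha.
pose th := w + a.
have ith : ring_of_integers th by apply: integral_add.
exists th => // x; split; last exact: int_adjoin_integral.
have jw : int_adjoin th w.
  (* Here th^2 = 3 w - 2 + 2 a w and th^3 = 3 w - 7 - 4 a + 5 a w: the combination 5 th^2 - 2 th^3
     loses a w, then -8 th removes a, leaving w + 4. *)
  exists (cubic (-4) (-8) 5 (-2)); rewrite horner_map_cubic /th.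
  ring: haw hw.
have ja : int_adjoin th a.
  have -> : a = th + (-1)%:~R * w by rewrite /th; ring.
  apply: int_adjoin_add (int_adjoin_gen _) _.
  exact: int_adjoin_mul (int_adjoin_intr _ _) jw.
have hm : exists n : int, -3 = 8 * n + 5 by exists (-1).
case/(integral_basis_mod8_5 hm sf _ _ _ ha hgen haw) => //.
move=> Y0 [Y1 [Y2 [Y3 ->]]].
do 3?apply: int_adjoin_add; rewrite ?mulrA;
  do ?apply: int_adjoin_mul; by [|exact: int_adjoin_intr].
Qed.

(** * The index form for m = 5 modulo 8 *)

Lemma int_adjoin_trans (K : fieldExtType rat) (a b x : K) :
  int_adjoin a b -> int_adjoin b x -> int_adjoin a x.
Proof.
move=> [q ->] [p ->]; exists (p \Po q).
by rewrite map_comp_poly horner_comp.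
Qed.

(** Allows the constant coordinate of a generator to be normalised. *)
Lemma int_adjoin_translate (K : fieldExtType rat) (a x : K) (c : int) :
  int_adjoin a x -> int_adjoin (a - c%:~R) x.
Proof.
apply: int_adjoin_trans; rewrite -[X in int_adjoin _ X](subrK c%:~R a).
exact: int_adjoin_add (int_adjoin_gen _) (int_adjoin_intr _ _).
Qed.

(** Horner's scheme, with a^4 replaced at each multiplication by a. *)
Lemma int_adjoin_degree4 (K : fieldExtType rat) (a x : K) (f0 f1 f2 f3 : int) :
  a ^+ 4 = f0%:~R + f1%:~R * a + f2%:~R * a ^+ 2 + f3%:~R * a ^+ 3 ->
  int_adjoin a x -> exists e0 e1 e2 e3 : int,
    x = e0%:~R + e1%:~R * a + e2%:~R * a ^+ 2 + e3%:~R * a ^+ 3.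
Proof.
move=> ha [p ->]; elim/poly_ind: p => [|p c [e0 [e1 [e2 [e3 IH]]]]].
  by exists 0, 0, 0, 0; rewrite rmorph0 horner0; ring.
exists (e3 * f0 + c), (e0 + e3 * f1), (e1 + e3 * f2), (e2 + e3 * f3).
rewrite rmorphD rmorphM /= map_polyX map_polyC.
rewrite hornerD hornerM hornerX hornerC IH.
ring: ha.
Qed.

(** The hypotheses say C M = 1, so det C is an inverse of det M; the long middle term is det (C M)
    expanded along its first row. *)
Lemma det3_unit (c11 c12 c13 c21 c22 c23 c31 c32 c33 : int)
    (m11 m12 m13 m21 m22 m23 m31 m32 m33 : int) :
  c11 * m11 + c12 * m21 + c13 * m31 = 1 ->
  c11 * m12 + c12 * m22 + c13 * m32 = 0 ->
  c11 * m13 + c12 * m23 + c13 * m33 = 0 ->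
  c21 * m11 + c22 * m21 + c23 * m31 = 0 ->
  c21 * m12 + c22 * m22 + c23 * m32 = 1 ->
  c21 * m13 + c22 * m23 + c23 * m33 = 0 ->
  c31 * m11 + c32 * m21 + c33 * m31 = 0 ->
  c31 * m12 + c32 * m22 + c33 * m32 = 0 ->
  c31 * m13 + c32 * m23 + c33 * m33 = 1 ->
  m11 * (m22 * m33 - m23 * m32) - m12 * (m21 * m33 - m23 * m31)
  + m13 * (m21 * m32 - m22 * m31) \is a GRing.unit.
Proof.
move=> h11 h12 h13 h21 h22 h23 h31 h32 h33; apply/unitrPr.
exists (c11 * (c22 * c33 - c23 * c32) - c12 * (c21 * c33 - c23 * c31)
  + c13 * (c21 * c32 - c22 * c31)).
transitivity
  ((c11 * m11 + c12 * m21 + c13 * m31) *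
    ((c21 * m12 + c22 * m22 + c23 * m32) * (c31 * m13 + c32 * m23 + c33 * m33)
    - (c21 * m13 + c22 * m23 + c23 * m33) * (c31 * m12 + c32 * m22 + c33 * m32))
  - (c11 * m12 + c12 * m22 + c13 * m32) *
    ((c21 * m11 + c22 * m21 + c23 * m31) * (c31 * m13 + c32 * m23 + c33 * m33)
    - (c21 * m13 + c22 * m23 + c23 * m33) * (c31 * m11 + c32 * m21 + c33 * m31))
  + (c11 * m13 + c12 * m23 + c13 * m33) *
    ((c21 * m11 + c22 * m21 + c23 * m31) * (c31 * m12 + c32 * m22 + c33 * m32)
    - (c21 * m12 + c22 * m22 + c23 * m32) * (c31 * m11 + c32 * m21 + c33 * m31))).
  by ring.
by rewrite h11 h12 h13 h21 h22 h23 h31 h32 h33; ring.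
Qed.

(** N is 1 or -1, so m s^2 is -3 or -5. As m = 5 modulo 8 gives m <= -3 or m >= 5, this forces s^2 =
    1, and m = -5 is in the wrong class. *)
Lemma index_form_unit (m N s : int) : (exists n : int, m = 8 * n + 5) ->
  - (N * (m * s ^+ 2 + 4 * N ^+ 2)) \is a GRing.unit -> m = -3.
Proof.
move=> [n hn]; rewrite unitrN unitrM => /andP[/int_unitE hN].
have -> : N ^+ 2 = 1 by case: hN => ->.
move=> /int_unitE h.
have s2 : 0 <= s ^+ 2 by exact: sqr_ge0.
have [s0|s0] := eqVneq (s ^+ 2) 0; first by rewrite s0 in h; lia.
have [hs|hs] : s ^+ 2 = 1 \/ 4 <= s ^+ 2.
- have : s != 0 by apply: contra s0 => /eqP ->.
  move=> s1; have [|s4] := eqVneq `|s| 1.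
    by move=> s1'; left; rewrite -real_normK ?num_real // s1'.
  by right; nia.
- by rewrite hs in h; lia.
- by nia.
Qed.

Lemma monogenic_mod8_5_eqN3 (K : fieldExtType rat) (m : int) :
  (exists n : int, m = 8 * n + 5) ->
  square_free m -> m <> 0 -> m <> 1 -> m <> -1 -> is_pure_quartic K m ->
  monogenic K -> m = -3.
Proof.
move=> hm sf m0 m1 mN1 [a ha hgen] [th ith hth].
have [n hn] : exists n : int, m = 4 * n + 1.
  by case: hm => n ->; exists (2 * n + 1); ring.
have [w haw hw] := quartic_omega hn ha.
have [c [u [y [v thE]]]] :=
  integral_basis_mod8_5 hm sf m0 m1 mN1 ha hgen haw ith.
(* Without a constant coordinate, the index is a 3 by 3 determinant. *)
pose X := th - c%:~R.
have XE : X = y%:~R * w + (u%:~R * a + v%:~R * (a * w)) by rewrite /X thE; ring.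
(* Each pair holds coordinates on 1 and w: al + be w = (u + v w)^2, g + h w = y^2 w^2 - a^2 (u + v
   w)^2, X^2 = (r + k w) + a (p + q w), ga + de w = (u + v w) (p + q w). Then A, W, B are the
   coordinates of X^3 on a, w, a w. *)
pose al := u ^+ 2 + n * v ^+ 2; pose be := 2 * u * v + v ^+ 2.
pose g := y ^+ 2 * n - 2 * n * be + al; pose h := y ^+ 2 - 2 * al - be.
pose r := 2 * y ^+ 2 * n - g; pose k := 2 * y ^+ 2 - h.
pose p := 2 * y * n * v; pose q := 2 * y * (u + v).
pose ga := u * p + n * v * q; pose de := u * q + v * p + v * q.
pose W := y * r + y * k + 2 * ga + de.
pose A := y * n * q + u * r + n * v * k.
pose B := y * p + y * q + u * k + v * r + v * k.
have X2 : X ^+ 2 = r%:~R + p%:~R * a + k%:~R * w + q%:~R * (a * w).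
  by rewrite XE /r /p /k /q /g /h /al /be; ring: haw hw.
have X3 : X ^+ 3 = (n * y * k + 2 * n * de - ga)%:~R + A%:~R * a + W%:~R * w
    + B%:~R * (a * w).
  rewrite exprS X2 XE /W /A /B /ga /de; ring: haw hw.
(* (X - y w)^2 = (2 w - 1) (u + v w)^2 reads X^2 - 2 y w X + g + h w = 0;
   multiplying by its conjugate under w -> 1 - w clears w. *)
have X4 : X ^+ 4 = (n * h ^+ 2 - g ^+ 2 - g * h)%:~R
    + (2 * y * g - 4 * n * h * y)%:~R * X
    + (4 * n * y ^+ 2 - 2 * g - h)%:~R * X ^+ 2 + (2 * y)%:~R * X ^+ 3.
  rewrite X3 exprS X3 X2 XE /W /A /B /ga /de /r /p /k /q /g /h /al /be.
  ring: haw hw.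
have sp x : ring_of_integers x -> exists e0 e1 e2 e3 : int,
    x = (e0 + e2 * r + e3 * (n * y * k + 2 * n * de - ga))%:~R
      + (e1 * u + e2 * p + e3 * A)%:~R * a
      + (e1 * y + e2 * k + e3 * W)%:~R * w
      + (e1 * v + e2 * q + e3 * B)%:~R * (a * w).
  move=> /hth/(int_adjoin_translate c)/(int_adjoin_degree4 X4).
  move=> [e0 [e1 [e2 [e3 ->]]]]; exists e0, e1, e2, e3.
  by rewrite -/X X3 X2 XE; ring.
have iw := integral_omega hw; have ia := integral_Xn_root (isT : 0 < 4)%N ha.
have eqc (x : K) (z0 z1 z2 z3 y0 y1 y2 y3 : int) :
    x = z0%:~R + z1%:~R * a + z2%:~R * w + z3%:~R * (a * w) ->
    x = y0%:~R + y1%:~R * a + y2%:~R * w + y3%:~R * (a * w) ->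
    [/\ z1 = y1, z2 = y2 & z3 = y3].
  move=> E1 E2.
  have : (z0 - y0)%:~R + (z1 - y1)%:~R * a + (z2 - y2)%:~R * w
       + (z3 - y3)%:~R * (a * w) = 0.
    by transitivity (x - x); [rewrite {1}E1 E2; ring | rewrite subrr].
  move/(quartic_omega_independent sf m0 m1 mN1 ha haw) => [_ ? ? ?].
  by split; lia.
(* Expressing w, a, a w through X, X^2, X^3 modulo Z yields an integral left inverse of the matrix
   of these powers, with columns ordered w, a, a w. *)
have [c0 [c1 [c2 [c3 Ew]]]] := sp w iw.
have [d0 [d1 [d2 [d3 Ea]]]] := sp a ia.
have [e0 [e1 [e2 [e3 Eaw]]]] := sp (a * w) (integral_mul ia iw).
have [|w1 w2 w3] := eqc _ _ _ _ _ 0 0 1 0 Ew; first by ring.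
have [|a1 a2 a3] := eqc _ _ _ _ _ 0 1 0 0 Ea; first by ring.
have [|b1 b2 b3] := eqc _ _ _ _ _ 0 0 0 1 Eaw; first by ring.
have := det3_unit w2 w1 w3 a2 a1 a3 b2 b1 b3.
have -> : y * (p * B - q * A) - u * (k * B - q * W) + v * (k * A - p * W)
  = - ((u ^+ 2 + u * v - n * v ^+ 2) * (m * (y ^+ 2 - v * (2 * u + v)) ^+ 2
       + 4 * (u ^+ 2 + u * v - n * v ^+ 2) ^+ 2)).
  by rewrite hn /W /A /B /ga /de /r /p /k /q /g /h /al /be; ring.
exact: index_form_unit.
Qed.

(** * The case m = 1 modulo 16 *)

Lemma half_sqr_sub (c : int) : exists d : int, c ^+ 2 = c + 2 * d.
Proof.
have [d [->|->]] := parity_cases c.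
  by exists (2 * d ^+ 2 - d); ring.
by exists (2 * d ^+ 2 + d); ring.
Qed.

Lemma not_monogenic_mod16_1 (K : fieldExtType rat) (m n : int) :
  m = 16 * n + 1 ->
  square_free m -> m <> 0 -> m <> 1 -> m <> -1 -> is_pure_quartic K m ->
  ~ monogenic K.
Proof.
move=> hn sf m0 m1 mN1 [a ha hgen] [th ith hth].
have hm4 : m = 4 * (4 * n) + 1 by rewrite hn; ring.
have hm8 : exists k : int, m = 8 * k + 1 by exists (2 * n); rewrite hn; ring.
have [w haw hw] := quartic_omega hm4 ha.
have n2 := intr_alg_neq0 K (isT : (2 : int) != 0).
pose e : K := w * (1 + a) / 2.
have hawe : a * w = 2 * e - w by rewrite /e; field.
(* The factor 16 in m - 1 makes the corrections to w e = e, a e = e and e^2 = e all even. *)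
have hwe : w * e = e + 2 * n%:~R * (1 + a).
  transitivity (w ^+ 2 * (1 + a) / 2); first by rewrite /e; field.
  by rewrite hw /e; field.
have hae : a * e = e + 4 * n%:~R.
  transitivity (w * (a + a ^+ 2) / 2); first by rewrite /e; field.
  rewrite haw; transitivity (w ^+ 2 + e - w); last by rewrite hw; ring.
  by rewrite /e; field.
have hee : e ^+ 2 = w * e + 2 * n%:~R * w.
  transitivity (e * w * (1 + a) / 2); first by rewrite /e; field.
  transitivity (w * (e + a * e) / 2); first by field.
  by rewrite hae; field.
have hee' : e ^+ 2 = e + 2 * n%:~R * (1 + a) + 2 * n%:~R * w.
  by rewrite hee hwe.
have iw := integral_omega hw; have ia := integral_Xn_root (isT : 0 < 4)%N ha.
have ie : ring_of_integers e.
  apply: (integral_quadratic iw _ hee); apply: integral_mul => //.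
  by have := integral_intr K (2 * n); rewrite rmorphM.
have basis := integral_basis_mod8_1 hm8 sf m0 m1 mN1 ha hgen haw hawe.
have [c0 [b [c [d thE]]]] := basis _ ith.
(* Subtracting b as well turns b a into b (a - 1), which kills t modulo 2 and has even square, as (a
   - 1)^2 = 2 (w - a). *)
pose y := th - (c0 + b)%:~R.
pose t := c%:~R * w + d%:~R * e.
have yE : y = b%:~R * (a - 1) + t by rewrite /y /t thE; ring.
have [c' hc] := half_sqr_sub c; have [d' hd] := half_sqr_sub d.
have hcK : c%:~R ^+ 2 = c%:~R + 2 * c'%:~R :> K.
  by rewrite -rmorphXn /= hc; ring.
have hdK : d%:~R ^+ 2 = d%:~R + 2 * d'%:~R :> K.
  by rewrite -rmorphXn /= hd; ring.
have comb (z0 z1 z2 z3 : int) : ring_of_integers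
    (z0%:~R + z1%:~R * a + z2%:~R * w + z3%:~R * e).
  do 3?apply: integral_add; do ?apply: integral_mul => //;
  exact: integral_intr.
(* Modulo 2, t is idempotent, since the cross term 2 c d w e vanishes; the witness collects the even
   remainders. *)
have yt : exists2 z, ring_of_integers z & y * t = t + 2 * z.
  exists ((2 * n * c ^+ 2 + n * d ^+ 2 + 2 * n * c * d + 2 * n * b * d)%:~R
    + (n * d ^+ 2 + 2 * n * c * d)%:~R * a
    + (c' + n * d ^+ 2 - b * c)%:~R * w + (d' + c * d + b * c)%:~R * e).
    exact: comb.
  transitivity (b%:~R * (c%:~R * (a * w - w) + d%:~R * (a * e - e))
    + (c%:~R ^+ 2 * w ^+ 2 + d%:~R ^+ 2 * e ^+ 2
       + 2 * c%:~R * d%:~R * (w * e))); first by rewrite yE /t; ring.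
  by rewrite hawe hae hw hee' hwe /t; ring: hcK hdK.
have yy : exists2 z, ring_of_integers z & y * y = t + 2 * z.
  have [z iz hz] := yt.
  exists (z + b%:~R * (c%:~R * (e - w) + (2 * n * d)%:~R)
          + (b ^+ 2)%:~R * (w - a)).
    have -> : z + b%:~R * (c%:~R * (e - w) + (2 * n * d)%:~R)
          + (b ^+ 2)%:~R * (w - a) = z + ((b * 2 * n * d)%:~R
          + (- b ^+ 2)%:~R * a + (b ^+ 2 - b * c)%:~R * w + (b * c)%:~R * e).
      by ring.
    exact: integral_add iz (comb _ _ _ _).
  transitivity (b%:~R ^+ 2 * (a ^+ 2 - 2 * a + 1)
    + b%:~R * (c%:~R * (a * w - w) + d%:~R * (a * e - e)) + y * t).
    by rewrite yE /t; ring.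
  by rewrite haw hawe hae hz; ring.
have [zy izy hy] := yy; have [zt izt ht] := yt.
(* Since y y = y t = t modulo 2, the group Z + Z y + Z t + 2 Z_K is stable under multiplication by
   y. *)
have sp x : int_adjoin y x -> exists al be ga : int,
    exists2 z, ring_of_integers z
      & x = al%:~R + be%:~R * y + ga%:~R * t + 2 * z.
  move=> [p ->]; elim/poly_ind: p => [|p k [al [be [ga [z iz IH]]]]].
    exists 0, 0, 0; exists 0; first exact: integral0.
    by rewrite rmorph0 horner0; ring.
  exists k, al, (be + ga), (be%:~R * zy + ga%:~R * zt + z * y).
    have iy : ring_of_integers y.
      by apply: integral_sub => //; exact: integral_intr.
    by do ?apply: integral_add; apply: integral_mul => //; exact: integral_intr.
  rewrite rmorphD rmorphM /= map_polyX map_polyC.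
  rewrite hornerD hornerM hornerX hornerC IH; ring: hy ht.
have sp2 x : ring_of_integers x -> exists be ga z0 z1 z2 z3 : int,
    x = z0%:~R + (be * b + 2 * z1)%:~R * a
        + ((be + ga) * c + 2 * z2)%:~R * w + ((be + ga) * d + 2 * z3)%:~R * e.
  move=> /hth/(int_adjoin_translate (c0 + b))/sp[al [be [ga [z /basis]]]].
  move=> [z0 [z1 [z2 [z3 ->]]]] ->.
  exists be, ga, (al - be * b + 2 * z0), z1, z2, z3.
  by rewrite -/y yE /t; ring.
have eqc (x : K) (z0 z1 z2 z3 y0 y1 y2 y3 : int) :
    x = z0%:~R + z1%:~R * a + z2%:~R * w + z3%:~R * e ->
    x = y0%:~R + y1%:~R * a + y2%:~R * w + y3%:~R * e ->
    [/\ z1 = y1, z2 = y2 & z3 = y3].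
  move=> E1 E2.
  have : (z0 - y0)%:~R + (z1 - y1)%:~R * a + (z2 - y2)%:~R * w
       + (z3 - y3)%:~R * e = 0.
    by transitivity (x - x); [rewrite {1}E1 E2; ring | rewrite subrr].
  move/(quartic_eta_independent sf m0 m1 mN1 ha haw hawe) => [_ ? ? ?].
  by split; lia.
have [bw [gw [B0 [B1 [B2 [B3 Ew]]]]]] := sp2 w iw.
have [be [ge [C0 [C1 [C2 [C3 Ee]]]]]] := sp2 e ie.
have [|w1 w2 w3] := eqc _ _ _ _ _ 0 0 1 0 Ew; first by ring.
have [|e1 e2 e3] := eqc _ _ _ _ _ 0 0 0 1 Ee; first by ring.
(* Modulo 2 the coordinates on w and e are always a multiple of (c, d), which cannot reach both (1,
   0) and (0, 1): e needs d odd, w needs an odd multiplier, and then w would have an odd coordinate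
   on e. *)
have [d2 [hd2|hd2]] := parity_cases d.
  by move: e3; rewrite hd2; lia.
have [k [hk|hk]] := parity_cases (bw + gw).
  by move: w2; rewrite hk; lia.
by move: w3; rewrite hk hd2; lia.
Qed.

(** * Assembling the residue classes modulo 16 *)

Theorem theorem4 (r k m : int)
    (hr : r \in [:: 1; 2; 3; 5; 6; 7; 10; 11; 13; 14; 15])
    (hm : m = r + 16 * k) (hsf : square_free m)
    (hm0 : m <> 0) (hm1 : m <> 1) (hmN1 : m <> -1)
    (K : fieldExtType rat) (hK : is_pure_quartic K m) :
  (r \in [:: 2; 3; 6; 7; 10; 11; 14; 15] -> monogenic K) /\
  (r \in [:: 1; 5; 13] ->
     (~ is_pure_quartic K (-3) -> ~ monogenic K) /\
     (is_pure_quartic K (-3) -> monogenic K)).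
Proof.
split=> [hr'|hr'].
  apply: (monogenic_mod4_2_3 _ hsf hm0 hm1 hmN1 hK).
  exists (m %/ 4)%Z; move: hr'; rewrite !inE hm.
  by do ?[case/orP]; move=> /eqP ->; lia.
split; last exact: monogenic_N3.
move=> hN3 hmono; move: hr'; rewrite !inE => /or3P[] /eqP er; subst r.
- have hm16 : m = 16 * k + 1 by rewrite hm; ring.
  exact: (not_monogenic_mod16_1 hm16 hsf hm0 hm1 hmN1 hK hmono).
(* Monogenicity would give m = -3, so K itself would be the exceptional field. *)
- apply: hN3; rewrite -(monogenic_mod8_5_eqN3 _ hsf hm0 hm1 hmN1 hK hmono) //.
  by exists (2 * k); rewrite hm; ring.
- apply: hN3; rewrite -(monogenic_mod8_5_eqN3 _ hsf hm0 hm1 hmN1 hK hmono) //.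
  by exists (2 * k + 1); rewrite hm; ring.
Qed.
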